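(* The following hold for the linear $H$-constants $H_L(\mathcal{A})$ of line arrangements $\mathcal{A}$ in projective planes. (1) Let $k$ be any field. If $r\in\mathbb{R}$ is an accumulation point of the set of values $H_L(\mathcal{A})$ for line arrangements $\mathcal{A}$ over $k$, then $r\in(-\infty,-2]$. (2) For a fixed prime $p>0$, the set of accumulation points of the values $H_L(\mathcal{A})$ for line arrangements $\mathcal{A}$ over fields of characteristic $p$ is $(-\infty,-2]$. (3) The set of accumulation points of the values $H_L(\mathcal{A})$ for line arrangements $\mathcal{A}$ over $\mathbb{R}$ is $[-3,-2]$.
   Context: For a field $k$, a line arrangement over $k$ is a finite collection of two or more (distinct) lines in the projective plane $\mathbb{P}^2_k$, a line being a set $\{[x,y,z]\in\mathbb{P}^2_k : ax+by+cz=0\}$ with $a,b,c\in k$ not all zero. For an arrangement $\mathcal{A}$ of $d$ lines and $m\ge 2$, $t_m$ denotes the number of points lying on exactly $m$ lines of $\mathcal{A}$. Standing assumption: all arrangements of $d$ lines considered satisfy $t_d=t_{d-1}=0$. The linear $H$-constant of $\mathcal{A}$ is $$H_L(\mathcal{A})= \frac{d^2-\sum_{m\geq 2} m^2 t_m}{\sum_{m\geq 2} t_m}.$$ Accumulation points are taken in $\mathbb{R}$, of the set of real numbers $H_L(\mathcal{A})$. *)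

(* Defs.v *)
From HB Require Import structures.
From mathcomp Require Import all_boot all_order all_algebra finmap.
From mathcomp Require Import all_classical all_reals all_analysis.

Set Implicit Arguments.
Unset Strict Implicit.
Unset Printing Implicit Defensive.

Import Order.TTheory GRing.Theory Num.Theory.
Import numFieldNormedType.Exports.

Local Open Scope classical_set_scope.
Local Open Scope ring_scope.

(* [x, y, z] is represented by the line k(x, y, z) of k^3. *)
Record proj_plane (k : fieldType) := ProjPoint {
  pt_space : {vspace 'rV[k]_3};
  _ : \dim pt_space == 1%N }.
HB.instance Definition _ (k : fieldType) := [isSub for @pt_space k].
HB.instance Definition _ (k : fieldType) := [Choice of proj_plane k by <:].

(* The points whose homogeneous coordinates v = (x, y, z) satisfy
   v *m abc = ax + by + cz = 0. *)
Definition line_of (k : fieldType) (abc : 'cV[k]_3) : set (proj_plane k) :=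
  [set P | forall v : 'rV[k]_3, v \in pt_space P -> v *m abc = 0].

Definition is_line (k : fieldType) (L : set (proj_plane k)) : Prop :=
  exists2 abc : 'cV[k]_3, abc != 0 & L = line_of abc.

Definition line_arrangement (k : fieldType)
    (A : {fset set (proj_plane k)}) : Prop :=
  (2 <= #|` A|)%N /\ forall L, L \in A -> is_line L.

Definition point_mult (k : fieldType) (A : {fset set (proj_plane k)})
    (P : proj_plane k) : nat :=
  #|` [fset L in A | P \in L]%fset|.

(* fset_set sends an infinite set to fset0, but for m >= 2 a line arrangement
   has only finitely many points of multiplicity m. *)
Definition tnum (k : fieldType) (A : {fset set (proj_plane k)}) (m : nat)
    : nat :=
  #|` fset_set [set P | point_mult A P = m]|.

(* The standing assumption t_d = t_(d-1) = 0 with d = #|` A|. *)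
Definition admissible (k : fieldType) (A : {fset set (proj_plane k)}) : Prop :=
  line_arrangement A /\ tnum A #|` A| = 0%N /\ tnum A #|` A|.-1 = 0%N.

(* The sums over m >= 2 stop at m = d: no point lies on more than d lines. *)
Definition HL (R : realType) (k : fieldType) (A : {fset set (proj_plane k)})
    : R :=
  let d := #|` A| in
  (d%:R ^+ 2 - \sum_(2 <= m < d.+1) m%:R ^+ 2 * (tnum A m)%:R)
    / \sum_(2 <= m < d.+1) (tnum A m)%:R.

Definition HL_values (R : realType) (k : fieldType) : set R :=
  [set HL R A | A in [set A : {fset set (proj_plane k)} | admissible A]].
Arguments HL_values : clear implicits.

Definition HL_values_pchar (R : realType) (p : nat) : set R :=
  [set h | exists k : fieldType, p \in [pchar k] /\ HL_values R k h].
Arguments HL_values_pchar : clear implicits.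

(* Main.v *)
(* Let d be the number of lines, s the number of multiple points and T the sum
   of their multiplicities m_P.  Counting pairs of lines gives
   sum m_P (m_P - 1) = d (d - 1), hence H_L = (d - T) / s.
   - Since m_P <= d - 2, (d - 1) (m_P - 2) >= (m_P + 1) (m_P - 2); summing over P
     gives H_L <= -2 + 2 / (d - 1).  As d bounds the number of possible values,
     only finitely many values exceed -2 + e, over all fields together.
   - Adding a generic line changes (d, s, T) to (d + 1, s + d, T + 2 d), so
     (H_L + 2) s grows by exactly 1: adding generic lines moves H_L up to -2 in
     steps that are small as soon as d / s is small.  It remains to start from
     arrangements with small H_L and small d / s.
   - Characteristic p: the lines y = a x + b over F_q, with a in a fixed number
     m of slopes, have H_L = - m q^2 / (q^2 + m), and d / s tends to 0.
   - Real case: the lines x cos t + y sin t = sin 3t for t = pi j / n, which are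
     tangent to a deltoid, meet three by three when n | i + j + l.  All but at
     most n of their multiple points are triple, so that H_L tends to -3.
   - Real lower bound: sweeping the affine plane, an injection of the faces with
     a leftmost vertex gives T <= 3 s + d, a weak form of Melchior's inequality
     which amounts to H_L >= -3. *)

Require Import Defs.
From HB Require Import structures.
From mathcomp Require Import all_boot all_order all_algebra finmap.
From mathcomp Require Import all_classical all_reals all_analysis.
From mathcomp Require Import finfield ring lra zify.

Set Implicit Arguments.
Unset Strict Implicit.
Unset Printing Implicit Defensive.

Import Order.TTheory GRing.Theory Num.Theory.
Import numFieldNormedType.Exports.

Local Open Scope classical_set_scope.
Local Open Scope ring_scope.

(** * Multiple points of an arrangement *)

Lemma cardfs_gt1P (T : choiceType) (A : {fset T}) :
  reflect (exists x y, [/\ x \in A, y \in A & x != y]) (1 < #|` A|)%N.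
Proof.
apply: (iffP idP) => [A1|[x [y [xA yA xy]]]].
  have /fset0Pn[x xA] : A != fset0 by rewrite -cardfs_gt0 ltnW.
  have /fset0Pn[y] : (A `\ x)%fset != fset0.
    by rewrite -cardfs_gt0; move: A1; rewrite (cardfsD1 x) xA.
  by rewrite !inE => /andP[yx yA]; exists x, y; split; rewrite // eq_sym.
have -> : (1 < #|` A|)%N = (#|` [fset x; y]%fset| <= #|` A|)%N by rewrite cardfs2 xy.
by apply/fsubset_leq_card/fsubsetP => z; rewrite !inE => /orP[] /eqP ->.
Qed.

(** * Points, lines and their intersections *)

Section ProjPlane.
Variable k : fieldType.
Implicit Types (P Q : proj_plane k) (A : {fset set (proj_plane k)}).
Implicit Types (L M : set (proj_plane k)) (c : 'cV[k]_3) (v : 'rV[k]_3).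

Definition rep P : 'rV[k]_3 := vpick (pt_space P).

Lemma rep_neq0 P : rep P != 0.
Proof. by rewrite vpick0 -dimv_eq0; case: P => U /= /eqP->. Qed.

Lemma pt_spaceE P : pt_space P = <[rep P]>%VS.
Proof.
apply/esym/eqP; rewrite eqEdim -memvE memv_pick dim_vline rep_neq0.
by case: P => U /= /eqP->.
Qed.

Lemma line_ofE c P : line_of c P <-> rep P *m c = 0.
Proof.
split=> [|h v]; first by apply; exact: memv_pick.
by rewrite pt_spaceE => /vlineP[a ->]; rewrite -scalemxAl h scaler0.
Qed.

Lemma mem_line_of c P : (P \in line_of c) = (rep P *m c == 0).
Proof. by apply/idP/eqP => [/set_mem/line_ofE|/line_ofE/mem_set]. Qed.

Lemma rep_inj P Q a : rep Q = a *: rep P -> Q = P.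
Proof.
move=> e; apply/val_inj; rewrite /= !pt_spaceE e.
have a0 : a != 0.
  by apply: contraNneq (rep_neq0 Q) => a0; rewrite e a0 scale0r.
apply/eqP; rewrite eqEdim !dim_vline scaler_eq0 negb_or a0 rep_neq0 /=.
by rewrite leqnn andbT -memvE memvZ// memv_line.
Qed.

Lemma exists_pt v : v != 0 -> exists P, exists2 a, a != 0 & rep P = a *: v.
Proof.
move=> v0; have dv : \dim <[v]> == 1%N by rewrite dim_vline v0.
have /vlineP[a e] : rep (ProjPoint dv) \in <[v]>%VS by exact: memv_pick.
have := rep_neq0 (ProjPoint dv); rewrite e scaler_eq0 negb_or => /andP[a0 _].
by exists (ProjPoint dv), a.
Qed.

Lemma line_of_scale c a : a != 0 -> line_of (a *: c) = line_of c.
Proof.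
move=> a0; apply/seteqP; split=> P; rewrite !line_ofE -scalemxAr; last by move=> ->; rewrite scaler0.
by move/eqP; rewrite scaler_eq0 (negbTE a0) => /eqP.
Qed.

(** If the matrix with columns [c] and [c'] had rank at most 1, [c'] would be a multiple of [c] and
    the lines would coincide. So its left kernel, which contains [rep P] and [rep Q], has rank at
    most 1. *)
Lemma meet_unique c c' P Q : line_of c <> line_of c' -> c != 0 -> c' != 0 ->
  rep P *m c = 0 -> rep P *m c' = 0 -> rep Q *m c = 0 -> rep Q *m c' = 0 ->
  P = Q.
Proof.
move=> ncc' c0 c'0 Pc Pc' Qc Qc'.
pose M := row_mx c c'.
have PM : (rep P <= kermx M)%MS by apply/sub_kermxP; rewrite mul_mx_row Pc Pc' row_mx0.
have QM : (rep Q <= kermx M)%MS by apply/sub_kermxP; rewrite mul_mx_row Qc Qc' row_mx0.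
suff rM : (\rank (kermx M) <= 1)%N.
  have rP : \rank (rep P) = 1%N by rewrite rank_rV rep_neq0.
  have : (kermx M <= rep P)%MS.
    by rewrite -(geq_leqif (mxrank_leqif_sup PM)) rP.
  by move=> /(submx_trans QM)/sub_rVP[a /rep_inj].
rewrite mxrank_ker leq_subLR addn1 ltnS.
rewrite leqNgt; apply/negP => rM; apply: ncc'.
have rc : \rank c^T = 1%N by rewrite rank_rV trmx_eq0 c0.
have cM : (c^T <= M^T)%MS by rewrite tr_row_mx -addsmxE addsmxSl.
have c'M : (c'^T <= M^T)%MS by rewrite tr_row_mx -addsmxE addsmxSr.
have : (M^T <= c^T)%MS.
  by rewrite -(geq_leqif (mxrank_leqif_sup cM)) rc mxrank_tr -ltnS.
move=> /(submx_trans c'M)/sub_rVP[a /(congr1 trmx)]; rewrite trmxK linearZ /= trmxK.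
move=> e; rewrite e line_of_scale //.
by apply: contraNneq c'0 => a0; rewrite e a0 scale0r.
Qed.

Lemma meet_exists c c' : exists P, rep P *m c = 0 /\ rep P *m c' = 0.
Proof.
pose M := row_mx c c'.
have : kermx M != 0.
  rewrite -mxrank_eq0 mxrank_ker subn_eq0 -ltnNge ltnS.
  exact: rank_leq_col.
case/rowV0Pn => v /sub_kermxP vM v0.
have [P [a a0 e]] := exists_pt v0; exists P.
move: vM; rewrite mul_mx_row -row_mx0 => /eq_row_mx[h h'].
by rewrite e -!scalemxAl h h' scaler0.
Qed.

Lemma lines_meet L M : is_line L -> is_line M -> L <> M ->
  exists2 P, (P \in L) && (P \in M) &
    forall Q, Q \in L -> Q \in M -> Q = P.
Proof.
move=> [c c0 ->] [c' c'0 ->] LM.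
have [P [h h']] := meet_exists c c'.
exists P => [|Q]; first by rewrite !mem_line_of h h' eqxx.
rewrite !mem_line_of => /eqP q /eqP q'.
exact: meet_unique LM _ _ _ _ _ _.
Qed.

(** * Counting incidences *)

Lemma point_multE A P : point_mult A P = (\sum_(L <- A) (P \in L))%N.
Proof.
rewrite /point_mult card_fset_sum1 big_fset /= big_mkcond /=.
by apply: eq_bigr => L _; case: (P \in L).
Qed.

Lemma point_mult_le A P : (point_mult A P <= #|` A|)%N.
Proof. by apply: fsubset_leq_card; apply/fsubsetP => L; rewrite !inE /= => /andP[]. Qed.

Lemma point_multP A P :
  reflect (exists L M, [/\ L \in A, M \in A, P \in L, P \in M & L != M])
          (2 <= point_mult A P)%N.
Proof.
rewrite /point_mult; apply: (iffP idP) => [/cardfs_gt1P[L [M []]]|].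
  rewrite !inE /= => /andP[LA PL] /andP[MA PM] LM.
  by exists L, M; split.
move=> [L [M [LA MA PL PM LM]]]; apply/cardfs_gt1P; exists L, M.
by split; rewrite ?inE /= ?LA ?MA.
Qed.

Definition verts A : {fset proj_plane k} :=
  fset_set [set P | (2 <= point_mult A P)%N].

(** Choosing a common point for each of the finitely many pairs of lines reaches every multiple
    point. *)
Lemma finite_verts A : line_arrangement A ->
  finite_set [set P | (2 <= point_mult A P)%N].
Proof.
move=> [_ lA].
have [[P0 _]|/set0P/negP/negPn/eqP->] :=
  pselect ([set P | (2 <= point_mult A P)%N] !=set0); last exact: finite_set0.
pose f (LM : set (proj_plane k) * set (proj_plane k)) :=
  if pselect (exists P, (P \in LM.1) && (P \in LM.2)) is left e
  then sval (cid e) else P0.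
have fD : finite_set [set LM | LM \in (A `*` A)%fset] by exact: finite_fset.
apply: sub_finite_set (finite_image f fD).
move=> Q /= /point_multP[L [M [LA MA QL QM LM]]].
exists (L, M); first by rewrite /= in_fsetM LA MA.
rewrite /f /=; case: pselect => [e|[]]; last by exists Q; rewrite QL QM.
have [P' _ u] := lines_meet (lA _ LA) (lA _ MA) (elimN eqP LM).
by case: (cid e) => /= P1 /andP[h h']; rewrite (u _ h h') (u Q).
Qed.

Lemma in_verts A P : line_arrangement A ->
  (P \in verts A) = (2 <= point_mult A P)%N.
Proof.
move=> lA; rewrite in_fset_set; last exact: finite_verts.
by apply/idP/idP => [/set_mem|h] //; exact: mem_set.
Qed.

(** For [m >= 2] the points counted are vertices, so their set is finite and [fset_set] does not
    fall back on its default value. *)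
Lemma tnumE A m : line_arrangement A -> (2 <= m)%N ->
  tnum A m = (\sum_(P <- verts A) (point_mult A P == m))%N.
Proof.
move=> lA m2; transitivity (\sum_(P <- [fset P in verts A | point_mult A P == m]%fset) 1)%N.
  rewrite -card_fset_sum1; congr #|` _|.
  apply/fsetP => P; rewrite !inE /= in_verts // in_fset_set; last first.
    by apply: sub_finite_set (finite_verts lA) => Q /= ->.
  apply/idP/andP => [/set_mem /= ->|[_ /eqP h]]; first by rewrite m2.
  exact/mem_set.
rewrite big_fset /= big_mkcond /=.
by apply: eq_bigr => P _; case: eqP.
Qed.

Lemma sum_mult A (R : nzRingType) (g : nat -> R) : line_arrangement A ->
  \sum_(2 <= m < #|` A|.+1) g m * (tnum A m)%:R =
  \sum_(P <- verts A) g (point_mult A P).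
Proof.
move=> lA; rewrite big_seq [RHS]big_seq.
transitivity (\sum_(2 <= m < #|` A|.+1)
    \sum_(P <- verts A) g m * (point_mult A P == m)%:R).
  rewrite -big_seq; apply: eq_big_nat => m /andP[m2 _].
  by rewrite tnumE // natr_sum mulr_sumr.
rewrite exchange_big /= big_seq; apply: eq_bigr => P; rewrite in_verts // => P2.
rewrite (bigD1_seq (point_mult A P)) ?iota_uniq //=; last first.
  by rewrite mem_index_iota P2 ltnS point_mult_le.
rewrite eqxx mulr1 big1 ?addr0 // => m mP.
by rewrite eq_sym (negbTE mP) mulr0.
Qed.

Lemma HLE (R : realType) A : line_arrangement A ->
  HL R A = (#|` A|%:R ^+ 2 - (\sum_(P <- verts A) point_mult A P ^ 2)%:R)
           / #|` verts A|%:R.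
Proof.
move=> lA; rewrite /HL (sum_mult (fun m => m%:R ^+ 2)) //.
have := sum_mult (fun=> 1 : R) lA.
rewrite (eq_bigr (fun m => (tnum A m)%:R)) => [->|m _]; last by rewrite mul1r.
rewrite natr_sum; congr ((_ - _) / _).
  by apply: eq_bigr => P _; rewrite natrX.
by rewrite card_fset_sum1 natr_sum.
Qed.

Lemma sum_meet A L M : line_arrangement A -> L \in A -> M \in A -> L != M ->
  (\sum_(P <- verts A) (P \in L) * (P \in M))%N = 1%N.
Proof.
move=> lA LA MA LM.
have [P /andP[PL PM] u] := lines_meet (lA.2 _ LA) (lA.2 _ MA) (elimN eqP LM).
have Pv : P \in verts A by rewrite in_verts //; apply/point_multP; exists L, M.
rewrite (big_fsetD1 P) //= PL PM big_seq big1 // => Q; rewrite !inE => /andP[QP _].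
case: (boolP (Q \in L)) => //= QL; case: (boolP (Q \in M)) => //= QM.
by rewrite (u Q) // eqxx in QP.
Qed.

(** Counts the triples (P, L, M) with P on L and M: the diagonal L = M gives the sum of the
    multiplicities, and each ordered pair of distinct lines gives one point. *)
Lemma sum_mult_sqr A : line_arrangement A ->
  (\sum_(P <- verts A) point_mult A P ^ 2 =
   #|` A| * #|` A|.-1 + \sum_(P <- verts A) point_mult A P)%N.
Proof.
move=> lA.
transitivity (\sum_(L <- A) \sum_(M <- A) \sum_(P <- verts A)
    (P \in L) * (P \in M))%N.
  under [RHS]eq_bigr do rewrite exchange_big.
  rewrite /= exchange_big /=; apply: eq_bigr => P _.
  rewrite !point_multE expnS expn1 big_distrl; apply: eq_bigr => L _ /=.
  by rewrite big_distrr.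
transitivity (\sum_(L <- A) (#|` A|.-1 + \sum_(P <- verts A) (P \in L)))%N.
  rewrite !big_seq; apply: eq_bigr => L LA.
  rewrite (big_fsetD1 L) //= addnC; congr addn; last first.
    by apply: eq_bigr => P _; case: (P \in L).
  rewrite (cardfsD1 L) LA add1n /= card_fset_sum1 !big_seq; apply: eq_bigr => M.
  rewrite !inE => /andP[ML MA].
  by apply: sum_meet; rewrite // eq_sym.
rewrite big_split /= exchange_big /=; congr addn.
  by rewrite big_const_seq count_predT iter_addn_0 mulnC.
by apply: eq_bigr => P _; rewrite point_multE.
Qed.

Lemma HL_sum_mult (R : realType) A : line_arrangement A ->
  HL R A = (#|` A|%:R - (\sum_(P <- verts A) point_mult A P)%:R)
           / #|` verts A|%:R.
Proof.
move=> lA; rewrite HLE // sum_mult_sqr //; congr (_ / _).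
case: #|` A| lA.1 => // d _ /=.
by rewrite natrD natrM -[X in _ - (X * _ + _)]natr1 -natr1; ring.
Qed.

Lemma verts_gt0 A : line_arrangement A -> (0 < #|` verts A|)%N.
Proof.
move=> lA; have /cardfs_gt1P[L [M [LA MA LM]]] := lA.1.
have [P /andP[PL PM] _] := lines_meet (lA.2 _ LA) (lA.2 _ MA) (elimN eqP LM).
rewrite cardfs_gt0; apply/fset0Pn; exists P; rewrite in_verts //.
by apply/point_multP; exists L, M.
Qed.

(** With [d >= 3], both d and d - 1 are at least 2, so that [tnum] counts vertices at these two
    values. *)
Lemma admissibleP A : (3 <= #|` A|)%N -> line_arrangement A ->
  admissible A <-> forall P, (point_mult A P <= #|` A| - 2)%N.
Proof.
move=> d3 lA; have d2 : (2 <= #|` A|.-1)%N by lia.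
split=> [[_ []]|h].
  rewrite !tnumE ?(ltnW d3) // => /eqP + /eqP; rewrite !sum_nat_seq_eq0.
  move=> /allP h /allP h' P.
  have := point_mult_le A P; case: (ltnP 1 (point_mult A P)) => P2; last by lia.
  rewrite -in_verts // in P2; have := h _ P2; have := h' _ P2 => /=; lia.
split=> //; rewrite !tnumE ?(ltnW d3) //.
by split; apply: big1 => P _; have := h P; case: eqP => //; lia.
Qed.

(** Two lines alone meet in a point of multiplicity d = 2. *)
Lemma admissible_ge3 A : admissible A -> (3 <= #|` A|)%N.
Proof.
move=> [lA [+ _]]; rewrite ltn_neqAle lA.1 andbT => h.
apply/eqP => d2; move: h; rewrite tnumE //; last by rewrite -d2.
have := verts_gt0 lA; rewrite cardfs_gt0 => /fset0Pn[P Pv].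
rewrite (big_fsetD1 P) //=; move: Pv; rewrite in_verts //.
have := point_mult_le A P; rewrite -d2 => *.
lia.
Qed.

End ProjPlane.

(** * The upper bound *)

Section UpperBound.
Variable R : realType.

Lemma HL_le (k : fieldType) (A : {fset set (proj_plane k)}) : admissible A ->
  HL R A <= -2 + 2 / (#|` A|.-1)%:R.
Proof.
move=> aA; have lA := aA.1; have d3 := admissible_ge3 aA.
have /admissibleP-/(_ d3 lA) mA := aA.
set d := #|` A| in d3 mA *.
have s0 := verts_gt0 lA.
(* The sum over P of (m + 1) (m - 2) <= (d - 1) (m - 2), rearranged to avoid subtraction. *)
have h : (d * d.-1 + 2 * (d.-1) * #|` verts A| <=
   d.-1 * \sum_(P <- verts A) point_mult A P + 2 * #|` verts A|)%N.
  have -> : (d * d.-1 = \sum_(P <- verts A) point_mult A P * (point_mult A P).-1)%N.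
    apply/eqP; rewrite -(eqn_add2r (\sum_(P <- verts A) point_mult A P)).
    rewrite -sum_mult_sqr // -big_split /=; apply/eqP/eq_bigr => P _.
    by case: point_mult => // m; rewrite /= -mulnSr expnS expn1.
  rewrite !card_fset_sum1 !big_distrr -!big_split /= !big_seq.
  apply: leq_sum => P; rewrite in_verts // => m2; have := mA P.
  by move: (point_mult _ _) m2 d3 => m m2 d3 md; nia.
rewrite HL_sum_mult // ler_pdivrMr ?ltr0n //.
have d1 : (d.-1)%:R != 0 :> R by rewrite pnatr_eq0; lia.
rewrite mulrDl mulrAC -subr_ge0.
rewrite -(@pmulr_rge0 _ (d.-1)%:R) ?ltr0n; last by lia.
move: h; rewrite -(ler_nat R) -subr_ge0 !natrD !natrM => h.
rewrite (_ : _ * _ = d.-1%:R * (\sum_(P <- verts A) point_mult A P)%N%:R +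
      2 * #|` verts A|%:R - (d%:R * d.-1%:R + 2 * d.-1%:R * #|` verts A|%:R)).
  by move: h; lra.
by rewrite -/d; field.
Qed.

(** Since m >= 2 at every vertex, T is at most half the sum Q of squares; with Q = d (d - 1) + T
    this bounds T, hence Q and the number of vertices. *)
Lemma sum_mult_bound (k : fieldType) (A : {fset set (proj_plane k)}) :
  line_arrangement A ->
  (\sum_(P <- verts A) point_mult A P ^ 2 <= 2 * #|` A| ^ 2)%N /\
  (#|` verts A| <= #|` A| ^ 2)%N.
Proof.
move=> lA; have := sum_mult_sqr lA.
have : (2 * \sum_(P <- verts A) point_mult A P <= \sum_(P <- verts A) point_mult A P ^ 2)%N.
  rewrite big_distrr /= !big_seq; apply: leq_sum => P; rewrite in_verts //; nia.
have : (#|` verts A| <= \sum_(P <- verts A) point_mult A P)%N.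
  rewrite card_fset_sum1 !big_seq; apply: leq_sum => P; rewrite in_verts //; lia.
nia.
Qed.

(** The value depends only on three natural numbers, all bounded in terms of [D]. The set [F] is
    chosen before the field, because a limit point may arise from values over varying fields. *)
Lemma finite_HL (D : nat) : exists2 F : set R, finite_set F &
  forall (k : fieldType) (A : {fset set (proj_plane k)}),
    line_arrangement A -> (#|` A| <= D)%N -> F (HL R A).
Proof.
pose N := (2 * D ^ 2).+1.
exists [set (x.1.1%:R ^+ 2 - x.1.2%:R) / x.2%:R
  | x in [set: 'I_D.+1 * 'I_N * 'I_N]].
  by apply: finite_image; exact: finite_finset.
move=> k A lA dD; rewrite HLE //.
have [Q S] := sum_mult_bound lA.
have QN : (\sum_(P <- verts A) point_mult A P ^ 2 < N)%N by rewrite /N; nia.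
have SN : (#|` verts A| < N)%N by rewrite /N; nia.
by exists (Ordinal (dD : #|` A| < D.+1)%N, Ordinal QN, Ordinal SN).
Qed.

Lemma limit_point_HL (E : set R) :
  (forall h, E h -> exists k : fieldType, HL_values R k h) ->
  limit_point E `<=` [set` `]-oo, (-2)]].
Proof.
move=> EV r /limit_point_infinite_setP rE /=; rewrite in_itv /= leNgt.
apply/negP => r2.
(* The number -2 + e is the midpoint of -2 and r; values above it force d - 1 < 2 / e. *)
pose e := (r + 2) / 2; have e0 : 0 < e by rewrite /e; lra.
have re : -2 + e < r by rewrite /e; lra.
have [F fF FP] := finite_HL (Num.truncn (2 / e)).+2.
apply: (rE [set x | -2 + e < x]); first exact: lt_nbhsr re.
apply: sub_finite_set fF => h [/= h2 /EV[k [A aA hA]]].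
rewrite -hA in h2 *; apply: FP; first exact: aA.1.
have d3 := admissible_ge3 aA.
have := lt_le_trans h2 (HL_le aA); rewrite ltrD2l => ed.
have d0 : 0 < (#|` A|.-1)%:R :> R by rewrite ltr0n; lia.
have : (#|` A|.-1)%:R < 2 / e by rewrite ltr_pdivlMr // mulrC -ltr_pdivlMr.
move=> /ltW; rewrite -truncn_ge_nat; first by lia.
by rewrite divr_ge0 // ltW.
Qed.

End UpperBound.

(** * Adding generic lines *)

(** On the curve t -> (1, t, t^2) each nonzero [v] restricts to a nonzero polynomial in t. The
    product of these has finitely many roots, while [f] makes [k] infinite. *)
Lemma avoid_forms (k : fieldType) (f : nat -> k) (s : seq 'rV[k]_3) :
  injective f -> all (fun v => v != 0) s ->
  exists2 c : 'cV[k]_3, c != 0 & all (fun v => v *m c != 0) s.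
Proof.
move=> fI s0.
pose p (v : 'rV[k]_3) := \poly_(i < 3) v 0 (inord i).
pose c (t : k) := \col_(i < 3) t ^+ i.
have pc v t : (v *m c t) 0 0 = (p v).[t].
  rewrite horner_poly !mxE; apply: eq_bigr => i _.
  by rewrite mxE inord_val.
have p0 v : v != 0 -> p v != 0.
  apply: contraNneq => pv; apply/eqP/rowP => i; rewrite mxE.
  by have := congr1 (coefp i) pv; rewrite /coefp /= coef_poly coef0 ltn_ord inord_val.
pose P := \prod_(v <- s) p v.
have P0 : P != 0.
  rewrite /P prodf_seq_neq0; apply/allP => v /(allP s0) /p0 pv.
  by rewrite pv implybT.
have [t tP] : exists t, ~~ root P t.
  apply/not_existsP => h.
  have : all (root P) (map f (iota 0 (size P))).
    by apply/allP => t _; have /negP/negPn := h t.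
  move=> /(max_poly_roots P0); rewrite map_inj_uniq // iota_uniq => /(_ isT).
  by rewrite size_map size_iota ltnn.
exists (c t).
  by apply/eqP => /matrixP/(_ 0 0); rewrite !mxE /= expr0 => /eqP; rewrite oner_eq0.
move: tP; rewrite /root horner_prod prodf_seq_neq0 => /allP h.
apply/allP => v vs; apply/eqP => /matrixP/(_ 0 0); rewrite pc mxE => e.
by have := h v vs; rewrite e eqxx.
Qed.

Section GenericLine.
Variables (k : fieldType) (f : nat -> k).
Hypothesis fI : injective f.
Variable A : {fset set (proj_plane k)}.
Hypothesis lA : line_arrangement A.

(** A line avoiding all vertices is not in [A], because every line of [A] meets another one and so
    carries a vertex. *)
Lemma exists_generic_line : exists L, [/\ is_line L, L \notin A &
  forall P, P \in verts A -> P \notin L].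
Proof.
have [|c c0 /allP h] := @avoid_forms k f (map (@rep k) (verts A)) fI.
  by apply/allP => _ /mapP[P _ ->]; exact: rep_neq0.
have cV P : P \in verts A -> P \notin line_of c.
  by move=> PV; rewrite mem_line_of; apply: h; exact: map_f.
exists (line_of c); split=> //; first by exists c.
apply/negP => cA; have := lA.1.
rewrite (cardfsD1 (line_of c)) cA ltnS cardfs_gt0 => /fset0Pn[M].
rewrite !inE => /andP[Mc MA].
have [P /andP[PL PM] _] := lines_meet (lA.2 _ cA) (lA.2 _ MA) (nesym (elimN eqP Mc)).
have /cV : P \in verts A.
  by rewrite in_verts //; apply/point_multP; exists (line_of c), M; rewrite eq_sym.
by rewrite PL.
Qed.

Variable L : set (proj_plane k).
Hypotheses (lL : is_line L) (LA : L \notin A).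
Hypothesis LV : forall P, P \in verts A -> P \notin L.

Lemma add_line_arrangement : line_arrangement (L |` A)%fset.
Proof.
split; first by rewrite cardfsU1 LA (leq_trans lA.1) ?leq_addl.
by move=> M; rewrite !inE => /orP[/eqP -> //|]; exact: lA.2.
Qed.

Lemma point_mult_add P : point_mult (L |` A)%fset P = ((P \in L) + point_mult A P)%N.
Proof. by rewrite !point_multE big_fsetU1. Qed.

Lemma generic_mult P : P \in L -> (point_mult A P <= 1)%N.
Proof. by rewrite leqNgt -in_verts //; apply: contraL => /LV. Qed.

(** The new line creates one double point on each line of [A] and leaves the old vertices unchanged.
    Taking [g] constant or the identity gives the changes of s and T. *)
Lemma sum_verts_add (g : nat -> nat) :
  (\sum_(P <- verts (L |` A)%fset) g (point_mult (L |` A)%fset P) =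
   #|` A| * g 2 + \sum_(P <- verts A) g (point_mult A P))%N.
Proof.
have lA' := add_line_arrangement.
have m1 P : P \in verts (L |` A)%fset -> P \in L -> point_mult A P = 1%N.
  rewrite in_verts // point_mult_add => + PL; rewrite PL => P1.
  by have := generic_mult PL; lia.
rewrite (bigID (fun P => P \in L)) /=; congr addn.
  (* Each vertex on [L] lies on exactly one line [M] of [A], so these vertices can be counted by
     [M]. *)
  transitivity (\sum_(M <- A) \sum_(P <- verts (L |` A)%fset)
      (P \in L) * (P \in M) * g 2)%N.
    rewrite exchange_big /= big_mkcond big_seq [RHS]big_seq.
    apply: eq_bigr => P PV; rewrite -big_distrl -big_distrr /= -point_multE.
    rewrite point_mult_add; case: (boolP (P \in L)) => [PL|]; last by rewrite !mul0n.
    by rewrite (m1 P) // !mul1n.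
  rewrite big_seq (eq_bigr (fun=> g 2)) => [|M MA]; last first.
    rewrite -big_distrl /= sum_meet ?mul1n ?inE ?eqxx ?MA ?orbT //.
    by apply: contraNneq LA => ->.
  by rewrite -big_seq big_const_seq count_predT iter_addn_0 mulnC.
rewrite (eq_bigr (fun P => g (point_mult A P))) => [|P /negbTE PL]; last first.
  by rewrite point_mult_add PL.
transitivity (\sum_(P <- [fset P in verts (L |` A) | P \notin L]%fset)
    g (point_mult A P))%N; first by rewrite big_fset.
congr (bigop _ _ _); congr enum_fset; apply/fsetP => P; rewrite !inE /= !in_verts // point_mult_add.
case: (boolP (P \in L)) => PL; last by rewrite andbT.
by rewrite andbF; apply/esym/negbTE; rewrite -in_verts //; apply: contraL PL => /LV.
Qed.

Lemma card_verts_add : #|` verts (L |` A)%fset| = (#|` A| + #|` verts A|)%N.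
Proof. by have := sum_verts_add (fun=> 1%N); rewrite -!card_fset_sum1 muln1. Qed.

Lemma admissible_add : admissible A -> admissible (L |` A)%fset.
Proof.
move=> aA; have d3 := admissible_ge3 aA.
have lA' := add_line_arrangement.
have /admissibleP-/(_ d3 lA) mA := aA.
have cA : #|` (L |` A)%fset| = #|` A|.+1 by rewrite cardfsU1 LA.
apply/admissibleP; rewrite ?cA ?(leqW d3) // => P; rewrite point_mult_add.
case: (boolP (P \in L)) => [PL|]; last by have := mA P; lia.
by have := generic_mult PL; lia.
Qed.

End GenericLine.

(** The relations give (H' - H) (d + s) = 1 - (H + 2) d, at most (1 + B) d < K (b - a) d <= (b - a)
    s. The lower bound persists since (H' + 2) (d + s) = (H + 2) s + 1. *)
Lemma HL_step (R : realFieldType) (a b B K d s T H H' : R) :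
  0 <= B -> 0 < K -> 1 + B < K * (b - a) -> 1 <= d -> 0 < s -> K * d <= s ->
  H * s = d - T -> H' * (d + s) = d + 1 - (d * 2 + T) -> -2 - B <= H <= a ->
  H' < b /\ -2 - B <= H'.
Proof.
move=> B0 K0 KB d1 s0 Ks Hs Hs' /andP[HB Ha].
have ba : 0 < b - a by rewrite -(pmulr_rgt0 _ K0); lra.
have sd0 : 0 < d + s by lra.
split.
  suff : (H' - H) * (d + s) < (b - a) * (d + s) by rewrite ltr_pM2r //; lra.
  apply: (@le_lt_trans _ _ ((1 + B) * d)).
    have : 0 <= (H + 2 + B) * d by rewrite mulr_ge0 //; lra.
    by lra.
  apply: (@lt_le_trans _ _ (K * (b - a) * d)); first by rewrite ltr_pM2r //; lra.
  by rewrite mulrAC [leRHS]mulrC ler_pM2r //; lra.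
have Bs : 0 <= (H + 2 + B) * s by rewrite mulr_ge0 //; lra.
have Bd : 0 <= B * d by rewrite mulr_ge0 //; lra.
suff : (-2 - B) * (d + s) <= H' * (d + s) by rewrite ler_pM2r.
by lra.
Qed.

(* B bounds |HL + 2| from the start on, and K bounds d and s / d from below; this
   is preserved by adding a generic line, which raises HL by less than b - a. *)
Lemma HL_density (R : realType) (k : fieldType) (f : nat -> k) (a b B K : R)
    (n : nat) (A : {fset set (proj_plane k)}) :
  injective f -> b <= -2 -> 0 <= B -> 0 < K -> 1 + B < K * (b - a) ->
  admissible A -> - 2 - B <= HL R A <= a ->
  K <= #|` A|%:R -> K * #|` A|%:R <= #|` verts A|%:R ->
  (\sum_(P <- verts A) point_mult A P <= #|` A| + 2 * #|` verts A| + n)%N ->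
  exists2 h, HL_values R k h & a < h < b.
Proof.
move=> fI b2 B0 K0 KB.
(* The excess T - d - 2 s, bounded by [n], drops by 1 with each generic line; this is the induction
   measure. *)
have arith (u v w m : nat) :
  (u <= v + 2 * w + m.+1 -> v * 2 + u <= v.+1 + 2 * (v + w) + m)%N by lia.
have ba : 0 < b - a by rewrite -(pmulr_rgt0 _ K0); lra.
elim: n A => [|n IH] A aA /andP[HB Ha] Kd Ks Tn.
  have lA := aA.1; have s0 := verts_gt0 lA.
  (* Once T <= d + 2 s, the value is at least -2, against [HL R A <= a < b <= -2]. *)
  suff : -2 <= HL R A by lra.
  rewrite HL_sum_mult // ler_pdivlMr ?ltr0n //.
  by move: Tn; rewrite addn0 -(ler_nat R) natrD natrM; lra.
have lA := aA.1; have d3 := admissible_ge3 aA.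
have [L [lL LA LV]] := exists_generic_line fI lA.
pose A' := (L |` A)%fset.
have aA' : admissible A' by exact: admissible_add.
have lA' := aA'.1.
have dA' : #|` A'| = #|` A|.+1 by rewrite cardfsU1 LA.
have sA' : #|` verts A'| = (#|` A| + #|` verts A|)%N by exact: card_verts_add.
have TA' : (\sum_(P <- verts A') point_mult A' P =
    #|` A| * 2 + \sum_(P <- verts A) point_mult A P)%N.
  exact: (sum_verts_add lA lL LA LV id).
have s0 := verts_gt0 lA.
have HA := HL_sum_mult R lA; have HA' := HL_sum_mult R lA'.
move: HA'; rewrite dA' sA' TA'.
set d := #|` A| in d3 Kd Ks Tn HA dA' sA' TA' *; set s := #|` verts A| in Ks Tn HA s0 sA' *.
set T := (\sum_(P <- verts A) point_mult A P)%N in Tn HA TA' *.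
have d1R : 1 <= d%:R :> R by rewrite ler1n; lia.
have s0R : 0 < s%:R :> R by rewrite ltr0n.
rewrite -natr1 !natrD natrM => HA'.
have HAs : HL R A * s%:R = d%:R - T%:R by rewrite HA divfK // gt_eqF.
have HAs' : HL R A' * (d%:R + s%:R) = d%:R + 1 - (d%:R * 2 + T%:R).
  by rewrite HA' divfK // gt_eqF // ltr_wpDl.
have [|step HB'] := HL_step B0 K0 KB d1R s0R Ks HAs HAs'; first by rewrite HB.
have [aH|Ha'] := ltP a (HL R A').
  by exists (HL R A'); [exists A'|rewrite aH].
apply: (IH A') => //; first by rewrite HB'.
- by rewrite dA' -natr1; lra.
- by rewrite dA' sA' -natr1 natrD; lra.
- by rewrite dA' sA' TA'; exact: arith.
Qed.

(** * The lower bound over the reals *)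

(** An injection given as a relation, so that images need not be chosen by hand. *)
Lemma card_le_rel (T U : finType) (F : {set T}) (r : T -> U -> bool) :
  (forall z, z \in F -> exists u, r z u) ->
  (forall z z' u, z \in F -> z' \in F -> r z u -> r z' u -> z = z') ->
  (#|F| <= #|U|)%N.
Proof.
move=> ex uq; pose f z := [pick u | r z u].
have fP z : z \in F -> exists2 u, f z = Some u & r z u.
  move=> zF; rewrite /f; case: pickP => [u ru|h]; first by exists u.
  by have [u] := ex z zF; rewrite h.
rewrite -(@card_in_imset _ _ f) => [|z z' zF z'F].
  rewrite -[#|U|]cardsT; apply: leq_trans (leq_imset_card (@Some U) _).
  by apply/subset_leq_card/fintype.subsetP => _ /imsetP[z /fP[u -> _] ->]; exact: imset_f.
have [u -> ru] := fP z zF; have [u' -> ru'] := fP z' z'F.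
by case=> e; rewrite -e in ru'; exact: uq zF z'F ru ru'.
Qed.

(** In a triangle cut out by three lines, the side of intermediate slope has the widest projection
    to the x-axis. *)
Lemma crossing (R : realFieldType) (ai aj al bi bj bl xP yP xQ yQ xS yS : R) :
  yP = ai * xP + bi -> yP = aj * xP + bj ->
  yQ = ai * xQ + bi -> yQ = al * xQ + bl ->
  yS = aj * xS + bj -> yS = al * xS + bl ->
  aj < ai -> ai < al -> xP < xQ -> xP < xS < xQ.
Proof.
move=> P1 P2 Q1 Q2 S1 S2 ji il PQ.
have lj : 0 < al - aj by lra.
rewrite -![_ < xS]subr_gt0 -[xS < _]subr_gt0.
rewrite -(pmulr_rgt0 (xS - xP) lj) -(pmulr_rgt0 (xQ - xS) lj).
have -> : (al - aj) * (xS - xP) = (al - ai) * (xQ - xP) by lra.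
have -> : (al - aj) * (xQ - xS) = (ai - aj) * (xQ - xP) by lra.
by rewrite !mulr_gt0 ?subr_gt0.
Qed.

Lemma exists_min (R : realDomainType) (T : finType) (p : pred T) (g : T -> R) t0 :
  p t0 -> exists2 t, p t & forall u, p u -> g t <= g u.
Proof. by move=> pt; case: (arg_minP g pt) => t; exists t. Qed.

(** * Charging the incidences to lines and vertices *)

Section Flags.
Variables (R : realFieldType) (I V : finType) (a b : I -> R) (x y : V -> R).
Variable inc : V -> I -> bool.
Hypothesis aI : injective a.
Hypothesis incE : forall P i, inc P i = (y P == a i * x P + b i).
Hypothesis incI : forall P Q i, inc P i -> inc Q i -> x P = x Q -> P = Q.
Hypothesis meetE : forall i j, i != j -> exists P, inc P i && inc P j.

(** The order of slopes at P is the vertical order of the lines just to the right of P, and the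
    reverse order just to its left. *)
Let lowest P i := inc P i && [forall j, inc P j ==> (a i <= a j)].
Let highest P i := inc P i && [forall j, inc P j ==> (a j <= a i)].
Let last i P := inc P i && [forall S, inc S i ==> (x S <= x P)].
Let next i P Q := [&& inc P i, inc Q i, x P < x Q &
  [forall S, inc S i ==> ((x S <= x P) || (x Q <= x S))]].
Let below P i j := [&& inc P i, inc P j, a j < a i &
  [forall l, inc P l ==> ((a l <= a j) || (a i <= a l))]].

Let lowest_uniq P i j : lowest P i -> lowest P j -> i = j.
Proof.
move=> /andP[Pi /forallP hi] /andP[Pj /forallP hj]; apply/aI/le_anti.
by rewrite (implyP (hi j) Pj) (implyP (hj i) Pi).
Qed.

Let highest_uniq P i j : highest P i -> highest P j -> i = j.
Proof.
move=> /andP[Pi /forallP hi] /andP[Pj /forallP hj]; apply/aI/le_anti.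
by rewrite (implyP (hi j) Pj) (implyP (hj i) Pi).
Qed.

Let last_uniq i P Q : last i P -> last i Q -> P = Q.
Proof.
move=> /andP[Pi /forallP hi] /andP[Qi /forallP hj]; apply: (incI Pi Qi).
by apply/le_anti; rewrite (implyP (hi Q) Qi) (implyP (hj P) Pi).
Qed.

Let prev_uniq i P P' Q : next i P Q -> next i P' Q -> P = P'.
Proof.
move=> /and4P[Pi _ PQ /forallP h] /and4P[Pi' _ PQ' /forallP h'].
apply: (incI Pi Pi'); apply/le_anti.
have := implyP (h P') Pi'; have := implyP (h' P) Pi.
by rewrite !(leNgt (x Q)) PQ PQ' !orbF => -> ->.
Qed.

Let above_uniq P i i' j : below P i j -> below P i' j -> i = i'.
Proof.
move=> /and4P[Pi _ ij /forallP h] /and4P[Pi' _ ij' /forallP h'].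
apply/aI/le_anti.
have := implyP (h i') Pi'; have := implyP (h' i) Pi.
by rewrite !(leNgt _ (a j)) ij ij' /= => -> ->.
Qed.

Let next_exists i P S : inc P i -> inc S i -> x P < x S ->
  exists2 Q, next i P Q & x Q <= x S.
Proof.
move=> Pi Si PS.
have [|Q /andP[Qi PQ] min] :=
  @exists_min _ _ (fun Q => inc Q i && (x P < x Q)) x S; first by rewrite Si.
exists Q; last by apply: min; rewrite Si.
rewrite /next Pi Qi PQ; apply/forallP => T; apply/implyP => Ti.
by case: (leP (x T) (x P)) => //= PT; apply: min; rewrite Ti.
Qed.

Let below_exists P i : inc P i -> ~~ lowest P i -> exists j, below P i j.
Proof.
move=> Pi; rewrite /lowest Pi => /forallPn[l]; rewrite negb_imply -ltNge => /andP[Pl li].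
have [|j /andP[Pj ji] min] :=
  @exists_min _ _ (fun j => inc P j && (a j < a i)) (fun j => - a j) l.
  by rewrite Pl.
exists j; rewrite /below Pi Pj ji; apply/forallP => m; apply/implyP => Pm.
case: (leP (a i) (a m)) => [|mi]; first by rewrite orbT.
by rewrite orbF -lerN2 min // Pm.
Qed.

(* The faces of the arrangement that have P as leftmost vertex correspond to
   the lines i that are not lowest at P, the face being just below i on the
   right of P.  A bounded face has a third vertex, either above or below its
   leftmost and rightmost ones: this is case 3 or 4. *)
Let flag_cases P i : inc P i ->
  [\/ lowest P i, last i P, exists Q, next i P Q && highest Q i |
      exists Q j, [&& below P i j, next j P Q & lowest Q j]].
Proof.
move=> Pi; have [lo|/below_exists-/(_ Pi)[j bj]] := boolP (lowest P i); first exact: Or41.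
have [la|] := boolP (last i P); first exact: Or42.
rewrite /last Pi => /forallPn[S0]; rewrite negb_imply -ltNge => /andP[S0i PS0].
have [Q nQ _] := next_exists Pi S0i PS0.
have [hi|] := boolP (highest Q i); first by apply: Or43; exists Q; rewrite nQ.
have /and4P[_ Qi PQ /forallP hQ] := nQ.
rewrite /highest Qi => /forallPn[l]; rewrite negb_imply -ltNge => /andP[Ql il].
have /and4P[_ Pj ji _] := bj.
(* The steeper line [l] through Q cuts [j] between P and Q, so [j] also has a next vertex Q', to the
   left of Q. *)
have [|S /andP[Sj Sl]] := meetE (_ : j != l).
  by apply: contraTneq il => <-; rewrite -leNgt ltW.
move: (Pi) (Pj) (Qi) (Ql) (Sj) (Sl); rewrite !incE => /eqP e1 /eqP e2 /eqP e3 /eqP e4 /eqP e5 /eqP e6.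
have /andP[PS SQ] := crossing e1 e2 e3 e4 e5 e6 ji il PQ.
have [Q' nQ' Q'S] := next_exists Pj Sj PS.
have [lo'|] := boolP (lowest Q' j).
  by apply: Or44; exists Q', j; rewrite bj nQ' lo'.
have /and4P[_ Q'j PQ' _] := nQ'.
(* If cases 3 and 4 both fail, a line [m] through Q' of smaller slope than [j] cuts [i] strictly
   between P and Q, which are consecutive on [i]. *)
rewrite /lowest Q'j => /forallPn[m]; rewrite negb_imply -ltNge => /andP[Q'm mj].
have [|S' /andP[S'i S'm]] := meetE (_ : i != m).
  by apply: contraTneq mj => <-; rewrite -leNgt ltW.
move: (Q'j) (Q'm) (S'i) (S'm); rewrite !incE => /eqP f3 /eqP f4 /eqP f5 /eqP f6.
(* The reflection y -> -y reverses the slopes and reduces this to [crossing]. *)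
have /andP[PS' S'Q'] : x P < x S' < x Q'.
  have neg (z A X B : R) : z = A * X + B -> - z = - A * X + - B by move=> ->; ring.
  by apply: (crossing (neg _ _ _ _ e2) (neg _ _ _ _ e1) (neg _ _ _ _ f3)
    (neg _ _ _ _ f4) (neg _ _ _ _ f5) (neg _ _ _ _ f6)); rewrite ?ltrN2.
have := implyP (hQ S') S'i.
by rewrite leNgt PS' leNgt (lt_trans S'Q' (le_lt_trans Q'S SQ)).
Qed.

(** Each case is injective: P determines its lowest line, and a line its last vertex. In case 3, Q
    determines [i], then P as its predecessor on [i]; in case 4, Q determines [j], then P, then [i]
    just above [j]. *)
Lemma flags_le : (\sum_P \sum_i inc P i <= #|I| + 3 * #|V|)%N.
Proof.
pose F0 := [set z : V * I | lowest z.1 z.2]%SET.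
pose F1 := [set z : V * I | last z.2 z.1]%SET.
pose F2 := [set z : V * I | [exists Q, next z.2 z.1 Q && highest Q z.2]]%SET.
pose F3 := [set z : V * I |
  [exists Q, exists j, [&& below z.1 z.2 j, next j z.1 Q & lowest Q j]]]%SET.
have h0 : (#|F0| <= #|V|)%N.
  apply: (@card_le_rel _ _ _ (fun z Q => z.1 == Q)) => [z _|]; first by exists z.1.
  move=> [P i] [P' i'] Q; rewrite !inE /= => hi hi' /eqP e /eqP e'.
  by rewrite e e' in hi hi' *; rewrite (lowest_uniq hi hi').
have h1 : (#|F1| <= #|I|)%N.
  apply: (@card_le_rel _ _ _ (fun z j => z.2 == j)) => [z _|]; first by exists z.2.
  move=> [P i] [P' i'] j; rewrite !inE /= => hi hi' /eqP e /eqP e'.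
  by rewrite e e' in hi hi' *; rewrite (last_uniq hi hi').
have h2 : (#|F2| <= #|V|)%N.
  apply: (@card_le_rel _ _ _ (fun z Q => next z.2 z.1 Q && highest Q z.2)) => [z|].
    by rewrite inE => /existsP.
  move=> [P i] [P' i'] Q _ _ /= /andP[n hi] /andP[n' hi'].
  have e := highest_uniq hi hi'; rewrite -e in n' *.
  by rewrite (prev_uniq n n').
have h3 : (#|F3| <= #|V|)%N.
  apply: (@card_le_rel _ _ _ (fun z Q =>
    [exists j, [&& below z.1 z.2 j, next j z.1 Q & lowest Q j]])) => [z|].
    by rewrite inE => /existsP.
  move=> [P i] [P' i'] Q _ _ /= /existsP[j /and3P[B n lo]] /existsP[j' /and3P[B' n' lo']].
  have e := lowest_uniq lo lo'; rewrite -e in n' B'.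
  have e' := prev_uniq n n'; rewrite -e' in B' *.
  by rewrite (above_uniq B B').
have -> : (\sum_P \sum_i inc P i = #|[set z : V * I | inc z.1 z.2]%SET|)%N.
  by rewrite pair_bigA /= -sum1_card [RHS]big_mkcond; apply: eq_bigr => z _; rewrite inE; case: inc.
have sub : [set z : V * I | inc z.1 z.2]%SET \subset (F0 :|: F1 :|: F2 :|: F3)%SET.
  apply/fintype.subsetP => -[P i]; rewrite !inE /= => /flag_cases[->//|->|[Q h]|[Q [j h]]].
  - by rewrite orbT.
  - by apply/orP; left; apply/orP; right; apply/existsP; exists Q.
  - by apply/orP; right; apply/existsP; exists Q; apply/existsP; exists j.
have := subset_leq_card sub.
have := leq_card_setU (F0 :|: F1 :|: F2)%SET F3; have := leq_card_setU (F0 :|: F1)%SET F2.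
have := leq_card_setU F0 F1; move=> [+ _] [+ _] [+ _]; lia.
Qed.

End Flags.

(** * Affine coordinates for an arrangement *)

Lemma complete_basis (k : fieldType) (e1 e2 : 'rV[k]_3) :
  exists e3, forall v : 'rV[k]_3, row_free (col_mx e1 e2) ->
    exists x y z, v = x *: e1 + y *: e2 + z *: e3.
Proof.
set M := col_mx e1 e2.
have /row_subPn[i Mi] : ~~ (1%:M <= M)%MS.
  apply/negP => /mxrankS; rewrite mxrank1.
  by apply/negP; rewrite -ltnNge ltnS rank_leq_row.
set e3 := row i _ in Mi; exists e3 => v /eqP rM.
have : (v <= M + e3)%MS.
  apply: submx_full; rewrite -col_leq_rank.
  have : (M < M + e3)%MS by rewrite ltmxE addsmxSl addsmx_sub submx_refl.
  by move=> /rank_ltmx; rewrite rM.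
move=> /sub_addsmxP[[D1 D2] /= ->].
rewrite -[D1]hsubmxK mul_row_col [lsubmx D1]mx11_scalar [rsubmx D1]mx11_scalar.
by rewrite [D2]mx11_scalar !mul_scalar_mx; do 3 eexists.
Qed.

Lemma dotD (k : fieldType) (u v : 'rV[k]_3) (c : 'cV[k]_3) :
  ((u + v) *m c) 0 0 = (u *m c) 0 0 + (v *m c) 0 0.
Proof. by rewrite mulmxDl mxE. Qed.

Lemma dotZ (k : fieldType) (x : k) (u : 'rV[k]_3) (c : 'cV[k]_3) :
  ((x *: u) *m c) 0 0 = x * (u *m c) 0 0.
Proof. by rewrite -scalemxAl mxE. Qed.

Lemma dot_eq0 (k : fieldType) (u : 'rV[k]_3) (c : 'cV[k]_3) :
  (u *m c == 0) = ((u *m c) 0 0 == 0).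
Proof.
apply/eqP/eqP => [->|h]; first by rewrite mxE.
by rewrite [LHS]mx11_scalar h raddf0.
Qed.

(** The point [e2] is taken on no line of [A], so no line is vertical and each equation can be
    scaled to y = a x + b. Then [e1] is taken so that all slopes differ: no two lines meet on the
    line at infinity spanned by [e1] and [e2]. *)
Lemma affine_coordinates (k : fieldType) (f : nat -> k)
    (A : {fset set (proj_plane k)}) : injective f -> line_arrangement A ->
  exists (a b : set (proj_plane k) -> k) (x y : proj_plane k -> k),
  [/\ {in A &, injective a},
      {in verts A & A, forall P L, (P \in L) = (y P == a L * x P + b L)} &
      {in verts A &, forall P Q, x P = x Q -> y P = y Q -> P = Q}].
Proof.
move=> fI lA.
have [c cP] : exists c : set (proj_plane k) -> 'cV[k]_3,
    forall L, L \in A -> c L != 0 /\ L = line_of (c L).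
  have /choice : forall L, exists c : 'cV[k]_3, L \in A -> c != 0 /\ L = line_of c.
    move=> L; have [LA|] := boolP (L \in A); last by exists 0.
    by have [c] := lA.2 _ LA; exists c.
  by move=> [c h]; exists c.
have [|e2' _ /allP h2] := @avoid_forms k f (map (fun L => (c L)^T) A) fI.
  by apply/allP => _ /mapP[L LA ->]; rewrite trmx_eq0 (cP L LA).1.
pose e2 := e2'^T; pose u L := (e2 *m c L) 0 0.
have u0 L : L \in A -> u L != 0.
  move=> LA; have := h2 _ (map_f _ LA); apply: contra_neq => uL.
  by apply: trmx_inj; rewrite trmx_mul trmxK trmx0 [LHS]mx11_scalar -/(u L) uL raddf0.
pose n L := (u L)^-1 *: c L.
have n2 L : L \in A -> (e2 *m n L) 0 0 = 1.
  by move=> LA; rewrite -scalemxAr mxE mulVf // u0.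
have nP L : L \in A -> L = line_of (n L).
  by move=> LA; rewrite line_of_scale ?invr_eq0 ?u0 // -(cP L LA).2.
have [|e1' _ /allP h1] := @avoid_forms k f
    [seq (n LM.1 - n LM.2)^T | LM <- enum_fset (A `*` A)%fset & LM.1 != LM.2] fI.
  apply/allP => _ /mapP[[L M] + ->]; rewrite mem_filter => /andP[/= LM].
  rewrite in_fsetM => /andP[/= LA MA]; rewrite trmx_eq0 subr_eq0.
  by apply: contraNneq LM => e; rewrite (nP L LA) (nP M MA) e.
pose e1 := e1'^T; pose a L := - (e1 *m n L) 0 0.
have aI : {in A &, injective a}.
  move=> L M LA MA e; apply/eqP/negPn/negP => LM.
  have : (n L - n M)^T *m e1' != 0.
    apply: h1; apply/mapP; exists (L, M) => //.
    by rewrite mem_filter /= LM in_fsetM /= LA MA.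
  rewrite -[_ *m _]trmxK trmx_eq0 trmx_mul trmxK -/e1 mulmxBr.
  rewrite [e1 *m n L]mx11_scalar [e1 *m n M]mx11_scalar.
  by move/oppr_inj: e => ->; rewrite subrr eqxx.
have /cardfs_gt1P[L [M [LA MA LM]]] := lA.1.
have aLM : a L != a M by apply: contra_neq LM; exact: aI.
(* A relation w1 e1 + w2 e2 = 0 gives w2 = w1 a for every slope a, and two slopes differ. *)
have free12 : row_free (col_mx e1 e2).
  rewrite -kermx_eq0; apply/rowV0P => w /sub_kermxP.
  rewrite -[w]hsubmxK mul_row_col [lsubmx w]mx11_scalar [rsubmx w]mx11_scalar !mul_scalar_mx.
  set w1 := lsubmx w 0 0; set w2 := rsubmx w 0 0 => w0.
  have wN N : N \in A -> w2 = w1 * a N.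
    move=> NA; have := congr1 (fun v => (v *m n N) 0 0) w0.
    rewrite dotD !dotZ n2 // mul0mx [RHS]mxE /a mulr1 => h.
    by apply/eqP; rewrite mulrN -subr_eq0 opprK addrC h.
  have : w1 * (a L - a M) = 0 by rewrite mulrBr -!wN // subrr.
  move/eqP; rewrite mulf_eq0 subr_eq0 (negbTE aLM) orbF => /eqP w10.
  by rewrite (wN L LA) w10 mul0r raddf0 row_mx0.
have [e3 /(_ _ free12) h3] := complete_basis e1 e2.
have /choice[X hX] : forall P : proj_plane k, exists X : k * k * k,
    rep P = X.1.1 *: e1 + X.1.2 *: e2 + X.2 *: e3.
  by move=> P; have [x [y [z e]]] := h3 (rep P); exists (x, y, z).
pose b N := - (e3 *m n N) 0 0.
have memE P N : N \in A ->
    (P \in N) = ((X P).1.2 == (X P).1.1 * a N + (X P).2 * b N).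
  move=> NA; rewrite {1}(nP N NA) mem_line_of dot_eq0 hX !dotD !dotZ n2 // mulr1.
  by rewrite -[RHS]subr_eq0 /a /b; congr (_ == _); ring.
(* At infinity, two lines of different slopes through P would force x = y = 0. *)
have z0 P : P \in verts A -> (X P).2 != 0.
  rewrite in_verts // => /point_multP[N [N' [NA N'A]]].
  rewrite !memE // => /eqP h /eqP h' NN'; apply/eqP => z0.
  rewrite z0 !mul0r !addr0 in h h'.
  have : (X P).1.1 * (a N - a N') = 0 by rewrite mulrBr -h -h' subrr.
  move/eqP; rewrite mulf_eq0 subr_eq0 (inj_in_eq aI) // (negbTE NN') orbF => /eqP x0.
  by have := rep_neq0 P; rewrite hX z0 h x0 mul0r !scale0r !addr0 eqxx.
exists a, b, (fun P => (X P).1.1 / (X P).2), (fun P => (X P).1.2 / (X P).2).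
split=> // [P N PV NA|P Q PV QV ex ey].
  have z := z0 P PV; rewrite memE // -[RHS](inj_eq (mulIf z)) divfK // mulrDl.
  by rewrite -[a N * _ * _]mulrA divfK // [a N * _]mulrC [b N * _]mulrC.
apply: (@rep_inj _ _ _ ((X P).2 / (X Q).2)).
rewrite hX [rep Q]hX -[(X P).1.1](divfK (z0 P PV)) -[(X P).1.2](divfK (z0 P PV)).
rewrite -[(X Q).1.1](divfK (z0 Q QV)) -[(X Q).1.2](divfK (z0 Q QV)) ex ey.
by rewrite !scalerDr !scalerA; congr (_ *: _ + _ *: _ + _ *: _); field; exact: z0.
Qed.

Lemma HL_ge (R : realType) (A : {fset set (proj_plane R)}) :
  line_arrangement A -> -3 <= HL R A.
Proof.
move=> lA.
have fI : injective (fun n : nat => n%:R : R) by exact: mulrIn (oner_neq0 _).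
have [a [b [x [y [aI memE xyI]]]]] := affine_coordinates fI lA.
have := @flags_le R A (verts A) (a \o val) (b \o val) (x \o val) (y \o val)
  (fun P L => val P \in val L).
rewrite -!cardfE => T.
have {}T : (\sum_(P <- verts A) point_mult A P <= #|` A| + 3 * #|` verts A|)%N.
  rewrite big_seq_fsetE /=; apply: leq_trans (T _ _ _ _).
  - by apply: leq_sum => P _; rewrite point_multE big_seq_fsetE.
  - by move=> L M /aI e; apply/val_inj/e; exact: valP.
  - by move=> P L; apply: memE; exact: valP.
  - move=> P Q L PL QL e; apply/val_inj/xyI => //; try exact: valP.
    by move: PL QL e; rewrite !memE ?fsvalP //= => /eqP -> /eqP -> ->.
  - move=> L M LM.
    have [P /andP[PL PM] _] := lines_meet (lA.2 _ (valP L)) (lA.2 _ (valP M))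
      (fun e => elimN eqP LM (val_inj e)).
    have PV : P \in verts A.
      rewrite in_verts //; apply/point_multP; exists (val L), (val M).
      by split=> //; exact: fsvalP.
    by exists [` PV]%fset; rewrite /= PL.
rewrite HL_sum_mult // ler_pdivlMr ?ltr0n ?verts_gt0 //.
by move: T; rewrite -(ler_nat R) natrD natrM; lra.
Qed.

(** * Nets of lines in positive characteristic *)

Section Family.
Variables (k : fieldType) (I : finType) (c : I -> 'cV[k]_3).
Hypotheses (cI : injective (fun i => line_of (c i))) (c0 : forall i, c i != 0).
Hypothesis I2 : (2 <= #|I|)%N.

Definition family_arrangement : {fset set (proj_plane k)} :=
  [fset line_of (c i) | i : I]%fset.

Lemma card_family : #|` family_arrangement| = #|I|.
Proof. by rewrite card_imfset //= -cardE. Qed.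

Lemma family_line_arrangement : line_arrangement family_arrangement.
Proof.
split; first by rewrite card_family.
by move=> _ /imfsetP[i _ ->]; exists (c i).
Qed.

Lemma family_mult P :
  point_mult family_arrangement P = (\sum_i (rep P *m c i == 0)%R)%N.
Proof.
rewrite point_multE big_imfset /=; last by move=> i j _ _ /cI.
rewrite big_enum /=; apply: eq_bigr => i _.
by rewrite mem_line_of.
Qed.

Lemma family_verts P : P \in verts family_arrangement ->
  exists i j, [/\ i != j, rep P *m c i = 0 & rep P *m c j = 0].
Proof.
rewrite in_verts; last exact: family_line_arrangement.
move=> /point_multP[_ [_ [/imfsetP[/= i _ ->] /imfsetP[/= j _ ->]]]].
rewrite !mem_line_of => /eqP Pi /eqP Pj ij; exists i, j; split=> //.
by apply: contra_neq ij => ->.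
Qed.

End Family.

(** * Lines of prescribed slopes over a finite field, seen over an extension *)

Section PositiveCharacteristic.
Variables (F : finFieldType) (k : fieldType) (h : {rmorphism F -> k}).
Variables (S : finType) (al : S -> F).
Hypothesis alI : injective al.
Hypothesis S3 : (3 <= #|S|)%N.
Let q := #|F|.

(* (s, b) stands for the line y = al s * x + b, inl (x, y) for an affine point
   and inr s for the point at infinity of slope al s. *)
Let cv (i : S * F) : 'cV[F]_3 := \col_j [:: al i.1; -1; i.2]`_j.
Let vc (w : F * F + S) : 'rV[F]_3 :=
  \row_j (match w with inl p => [:: p.1; p.2; 1] | inr s => [:: 1; al s; 0] end)`_j.
Let c i := map_mx h (cv i).

Let dot w i : (vc w *m cv i) 0 0 =
  match w with inl p => al i.1 * p.1 - p.2 + i.2 | inr s => al i.1 - al s end.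
Proof.
by rewrite mxE !big_ord_recl big_ord0 !mxE; case: w => [[x y]|s] /=; ring.
Qed.

Let vc0 w : map_mx h (vc w) != 0.
Proof.
rewrite map_mx_eq0; apply/eqP => /rowP e; case: w e => [p|s] e.
  by have := e (inord 2); rewrite !mxE inordK //= => /eqP; rewrite oner_eq0.
by have := e (inord 0); rewrite !mxE inordK //= => /eqP; rewrite oner_eq0.
Qed.

Let pts : {pt : F * F + S -> proj_plane k |
  forall w, exists2 t, t != 0 & rep (pt w) = t *: map_mx h (vc w)}.
Proof.
apply: cid; have /choice[pt ptP] : forall w, exists P, exists2 t : k,
    t != 0 & rep P = t *: map_mx h (vc w) by move=> w; exact: exists_pt (vc0 w).
by exists pt.
Qed.
Let pt := sval pts.

Let ptE w i : (rep (pt w) *m c i == 0) = ((vc w *m cv i) 0 0 == 0).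
Proof.
rewrite /pt; case: pts => /= p /(_ w)[t t0 ->].
rewrite -scalemxAl -map_mxM scaler_eq0 (negbTE t0) map_mx_eq0.
exact: dot_eq0.
Qed.

Let ptI : injective pt.
Proof.
move=> w w'; rewrite /pt; case: pts => /= p ptP e.
have [t t0 ew] := ptP w; have [t' t'0] := ptP w'; rewrite -e ew => /rowP E.
have E0 := E (inord 0); have E1 := E (inord 1); have E2 := E (inord 2).
move: E0 E1 E2; rewrite !mxE !inordK //=.
case: w w' {e ew E} => [[x y]|s] [[x' y']|s'] /=; rewrite ?rmorph1 ?rmorph0 ?mulr1 ?mulr0.
- move=> + + tt; rewrite tt => /(mulfI t'0)/fmorph_inj -> /(mulfI t'0)/fmorph_inj ->.
  by [].
- by move=> _ _ /eqP; rewrite (negbTE t0).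
- by move=> _ _ /esym/eqP; rewrite (negbTE t'0).
- by move=> -> /(mulfI t'0)/fmorph_inj/alI ->.
Qed.

Let cI : injective (fun i => line_of (c i)).
Proof.
move=> [s b] [s' b'] /= e.
have H w : (rep (pt w) *m c (s, b) == 0) = (rep (pt w) *m c (s', b') == 0).
  by rewrite -!mem_line_of e.
have := H (inr s); rewrite !ptE !dot /= subrr eqxx => /esym.
rewrite subr_eq0 (inj_eq alI) => /eqP ss'; rewrite ss' in H *.
have := H (inl (0, b)); rewrite !ptE !dot /= mulr0 add0r addNr eqxx => /esym.
by rewrite addrC subr_eq0 => /eqP ->.
Qed.

Let c0 i : c i != 0.
Proof.
rewrite map_mx_eq0; apply/eqP => /colP/(_ (inord 1)).
by rewrite !mxE inordK //= => /eqP; rewrite oppr_eq0 oner_eq0.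
Qed.

Let q2 : (2 <= q)%N.
Proof. by rewrite (leq_trans (ltnW S3)) //; exact: leq_card alI. Qed.

Let cardI : #|{: S * F}| = (#|S| * q)%N.
Proof. by rewrite card_prod. Qed.

Let I2 : (2 <= #|{: S * F}|)%N.
Proof. by rewrite cardI; move: S3 q2; nia. Qed.

Let A := family_arrangement c.
Let lA : line_arrangement A := family_line_arrangement cI c0 I2.

(** For each slope a single intercept fits a given affine point. *)
Let mult_inl p : point_mult A (pt (inl p)) = #|S|.
Proof.
rewrite (family_mult cI) -(pair_bigA _ (fun s b => (rep (pt (inl p)) *m c (s, b) == 0) : nat)) /=.
rewrite -sum1_card; apply: eq_bigr => s _.
rewrite (bigD1 (p.2 - al s * p.1)) //= ptE dot /=.
rewrite big1 => [|b].
  have -> : al s * p.1 - p.2 + (p.2 - al s * p.1) = 0 by ring.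
  by rewrite eqxx.
move=> bn; rewrite ptE dot /=; apply/eqP; rewrite eqb0; apply: contra bn.
by move=> /eqP e; rewrite -subr_eq0 -e; apply/eqP; ring.
Qed.

Let mult_inr s : point_mult A (pt (inr s)) = q.
Proof.
rewrite (family_mult cI) -(pair_bigA _ (fun s' b => (rep (pt (inr s)) *m c (s', b) == 0) : nat)) /=.
rewrite (bigD1 s) //= [X in (_ + X)%N]big1 ?addn0.
  by rewrite -[RHS]sum1_card; apply: eq_bigr => b _; rewrite ptE dot subrr eqxx.
move=> s' s's; apply: big1 => b _; rewrite ptE dot /= subr_eq0 (inj_eq alI).
by rewrite (negbTE s's).
Qed.

(** Equal slopes meet at infinity; distinct slopes meet at a point with coordinates in [F]. So the
    extension [k] brings no further vertices. *)
Let vertsA : verts A = [fset pt w | w : F * F + S]%fset.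
Proof.
apply/fsetP => P; apply/idP/imfsetP => /= [|[w _ ->]]; last first.
  rewrite in_verts //; case: w => [p|s]; rewrite ?mult_inl ?mult_inr //.
  exact: ltnW S3.
move=> /(family_verts cI c0 I2)[i [j [ij Pi Pj]]].
suff [w /eqP wi /eqP wj] : exists2 w, rep (pt w) *m c i == 0 & rep (pt w) *m c j == 0.
  exists w => //; apply: (meet_unique _ (c0 i) (c0 j)) => // /cI e.
  by rewrite e eqxx in ij.
case: i j ij {Pi Pj} => [s b] [s' b'].
have [<- bb|ss' _] := eqVneq s s'; first by exists (inr s); rewrite ptE dot subrr.
have d0 : al s - al s' != 0 by rewrite subr_eq0 (inj_eq alI).
pose x := (b' - b) / (al s - al s'); exists (inl (x, al s * x + b)); rewrite ptE dot /=.
  by rewrite opprD addrA addrN add0r addNr.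
have e : x * (al s - al s') = b' - b by rewrite divfK.
clearbody x; have -> : b' = x * (al s - al s') + b by rewrite e subrK.
by apply/eqP; ring.
Qed.

Let sumV (g : nat -> nat) : (\sum_(P <- verts A) g (point_mult A P) =
  q ^ 2 * g #|S| + #|S| * g q)%N.
Proof.
rewrite vertsA big_imfset /=; last by move=> w w' _ _ /ptI.
rewrite big_enum /= big_sumType /=; congr addn.
  rewrite (eq_bigr (fun=> g #|S|)) => [|p _]; last by rewrite mult_inl.
  by rewrite sum_nat_const card_prod expnS expn1.
rewrite (eq_bigr (fun=> g q)) => [|p _]; last by rewrite mult_inr.
by rewrite sum_nat_const.
Qed.

Lemma slope_arrangement : exists A : {fset set (proj_plane k)},
  [/\ admissible A, #|` A| = (#|S| * #|F|)%N,
      #|` verts A| = (#|F| ^ 2 + #|S|)%N &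
      (\sum_(P <- verts A) point_mult A P = #|F| ^ 2 * #|S| + #|S| * #|F|)%N].
Proof.
exists A; have dA : #|` A| = (#|S| * q)%N by rewrite card_family.
split=> //; [|by have := sumV (fun=> 1%N); rewrite -card_fset_sum1 !muln1|exact: sumV id].
have d3 : (3 <= #|` A|)%N by rewrite dA; move: S3 q2; nia.
apply/admissibleP => // P; rewrite dA.
have ar (u v : nat) : (3 <= u -> 2 <= v -> u <= u * v - 2 /\ v <= u * v - 2)%N by nia.
have [uS uq] := ar _ _ S3 q2.
have [|] := ltnP 1 (point_mult A P); last first.
  by move=> m1; apply: leq_trans uS; apply: leq_trans m1 _; exact: ltnW (ltnW S3).
rewrite -in_verts // vertsA => /imfsetP[/= [p|s] _ ->].
  by rewrite mult_inl.
by rewrite mult_inr.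
Qed.

End PositiveCharacteristic.

Lemma pchar_density (R : realType) (p : nat) (a b : R) : prime p ->
  a < b -> b <= -2 -> exists2 h, HL_values_pchar R p h & a < h < b.
Proof.
move=> pp ab b2.
(* As soon as q >= m, the bound m >= 1 - a gives - m q^2 / (q^2 + m) <= a. *)
pose m := (Num.truncn (- a)).+3.
have ma : - a + 1 <= m%:R.
  have : - a < (Num.truncn (- a)).+1%:R by exact: truncnS_gt.
  by have -> : m%:R = (Num.truncn (- a)).+1%:R + 2 :> R;
    [rewrite -natrD addn2|lra].
pose K := (Num.truncn ((1 + m%:R) / (b - a))).+1.
have KP : 1 + m%:R < K%:R * (b - a).
  by rewrite -ltr_pdivrMr ?subr_gt0 //; exact: truncnS_gt.
(* With q >= K m, the q^2 + m vertices number at least K times the m q lines. *)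
have [F pF qF] := PrimePowerField pp (isT : 0 < (K * m).+1)%N.
have qK : (K * m <= #|F|)%N.
  by rewrite qF (leq_trans (leqnSn _)) // ltnW // ltn_expl // prime_gt1.
(* Generic lines require an infinite field, here F(X), made infinite by the powers of X. *)
pose k : fieldType := {fraction {poly F}}.
pose h : {rmorphism F -> k} := (@tofrac {poly F} \o @polyC F).
pose f (n : nat) : k := tofrac 'X^n.
have fI : injective f.
  move=> i j /eqP; rewrite tofrac_eq => /eqP/(congr1 (fun p : {poly F} => size p)).
  by rewrite !size_polyXn => -[].
have mq : (m <= #|F|)%N by rewrite (leq_trans _ qK) // leq_pmull.
pose al (s : 'I_m) : F := enum_val (widen_ord mq s).
have alI : injective al by move=> i j /enum_val_inj/(congr1 val) /= e; apply/val_inj.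
have [|A [aA dA sA TA]] := @slope_arrangement F k h _ al alI; first by rewrite card_ord.
rewrite card_ord in dA sA TA; move: dA sA TA qK (mq); set q := #|F| => dA sA TA qK mq'.
have m0 : 3 <= m%:R :> R by rewrite (ler_nat _ 3).
have K0 : 1 <= K%:R :> R by rewrite (ler_nat _ 1).
have qm : m%:R <= q%:R :> R by rewrite ler_nat.
have s0 : 0 < q%:R ^+ 2 + m%:R :> R by rewrite ltr_wpDl ?exprn_ge0 //; lra.
have HA : HL R A * (q%:R ^+ 2 + m%:R) = - (m%:R * q%:R ^+ 2).
  rewrite HL_sum_mult ?dA ?sA ?TA; last exact: aA.1.
  have -> : (q ^ 2 + m)%:R = q%:R ^+ 2 + m%:R :> R by rewrite natrD natrX.
  rewrite divfK ?gt_eqF // !natrD !natrM; ring.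
(* The starting value is at least -m, so B = m serves; T itself bounds its own excess. *)
have [|||||| h0 hV hab] := @HL_density R k f a b m%:R K%:R
    (\sum_(P <- verts A) point_mult A P)%N A fI b2 _ _ KP aA.
- by [].
- by lra.
- apply/andP; split.
    rewrite -(ler_pM2r s0) HA.
    have : 0 <= m%:R * m%:R :> R by rewrite mulr_ge0.
    have : 0 <= q%:R ^+ 2 :> R by rewrite exprn_ge0.
    by nra.
  rewrite -(ler_pM2r s0) HA.
  have : m%:R * m%:R <= q%:R ^+ 2 :> R by rewrite expr2 ler_pM.
  have : 0 <= (m%:R + a - 1) * (q%:R ^+ 2) by rewrite mulr_ge0 ?exprn_ge0 //; lra.
  have : 0 <= (m%:R + a - 1) * m%:R by rewrite mulr_ge0 //; lra.
  by lra.
- by rewrite dA ler_nat; move: qK; rewrite /m; nia.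
- by rewrite dA sA -natrM ler_nat; nia.
- by lia.
- by exists h0 => //; exists k; split=> //; exact: rmorph_pchar h _ pF.
Qed.

(** * Tangents to a deltoid *)

Section Deltoid.
Variable R : realType.

Lemma sin_add_natpi (x : R) q : sin (x + q%:R * pi) = (-1) ^+ q * sin x.
Proof.
elim: q => [|q IH]; first by rewrite mul0r addr0 expr0 mul1r.
by rewrite -natr1 mulrDl mul1r addrA sinDpi IH exprS mulN1r mulNr.
Qed.

(** Removing multiples of pi leaves an angle in [0, pi), where the sine vanishes only at 0. *)
Lemma sin_fracpi_eq0 n m : (0 < n)%N ->
  (sin (m%:R * pi / n%:R : R) == 0) = (n %| m)%N.
Proof.
move=> n0; have nR : n%:R != 0 :> R by rewrite pnatr_eq0 -lt0n.
have -> : m%:R * pi / n%:R = (m %% n)%:R * pi / n%:R + (m %/ n)%:R * pi :> R.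
  by rewrite {1}(divn_eq m n) natrD natrM; field.
rewrite sin_add_natpi mulf_eq0 signr_eq0 /= /dvdn.
case: (posnP (m %% n)) => [->|r0]; first by rewrite !mul0r sin0 !eqxx.
apply: gt_eqF; apply: sin_gt0_pi.
rewrite divr_gt0 ?mulr_gt0 ?ltr0n ?pi_gt0 //=.
by rewrite ltr_pdivrMr ?ltr0n // mulrC ltr_pM2l ?pi_gt0 // ltr_nat ltn_mod.
Qed.

(* sin3 t = sin (3 t) *)
Definition sin3 (t : R) : R := 3 * sin t * cos t ^+ 2 - sin t ^+ 3.

(* The determinant of (cos t, sin t, sin 3t) at t = a, b, c is, up to a factor
   4, the product of sin (a - b), sin (b - c), sin (c - a) and sin (a + b + c). *)
Lemma deltoid_identity (a b c x y z : R) :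
  sin (b - a) * (x * cos c + y * sin c - z * sin3 c) =
  sin (b - c) * (x * cos a + y * sin a - z * sin3 a) +
  sin (c - a) * (x * cos b + y * sin b - z * sin3 b) +
  4 * z * (sin (a - b) * sin (b - c) * sin (c - a) * sin (a + b + c)).
Proof.
rewrite /sin3 !sinB !sinD !cosD.
have := cos2Dsin2 a; have := cos2Dsin2 b; have := cos2Dsin2 c.
move: (sin a) (cos a) (sin b) (cos b) (sin c) (cos c) => sa ca sb cb sc cc rc rb ra.
(* Factors cos^2 + sin^2 make every term homogeneous of degree 3 in each angle; the identity then
   holds for arbitrary variables. *)
suff : (sb * ca - cb * sa) * (3 * sc * cc ^+ 2 - sc ^+ 3)
    * (ca ^+ 2 + sa ^+ 2) * (cb ^+ 2 + sb ^+ 2) =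
  (sb * cc - cb * sc) * (3 * sa * ca ^+ 2 - sa ^+ 3)
    * (cb ^+ 2 + sb ^+ 2) * (cc ^+ 2 + sc ^+ 2) +
  (sc * ca - cc * sa) * (3 * sb * cb ^+ 2 - sb ^+ 3)
    * (ca ^+ 2 + sa ^+ 2) * (cc ^+ 2 + sc ^+ 2) -
  4 * ((sa * cb - ca * sb) * (sb * cc - cb * sc) * (sc * ca - cc * sa) *
   ((sa * cb + ca * sb) * cc + (ca * cb - sa * sb) * sc)).
  rewrite ra rb rc !mulr1 => e.
  rewrite mulrBr (mulrCA (_ - _) z) e; ring.
ring.
Qed.

Variable n : nat.
Hypothesis n5 : (5 <= n)%N.

Let n0 : (0 < n)%N. Proof. by lia. Qed.

Let th (j : nat) : R := j%:R * pi / n%:R.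

Let sin_diff (i j : 'I_n) : i != j -> sin (th j - th i) != 0.
Proof.
have H (i' j' : 'I_n) : (i' < j')%N -> sin (th j' - th i') != 0.
  move=> ij; have -> : th j' - th i' = (j' - i')%:R * pi / n%:R.
    by rewrite /th natrB ?(ltnW ij) // !mulrBl.
  rewrite sin_fracpi_eq0 // gtnNdvd ?subn_gt0 //.
  by rewrite (leq_ltn_trans (leq_subr _ _)).
rewrite neq_ltn => /orP[/H //|/H]; by rewrite -oppr_eq0 -sinN opprB.
Qed.

Let sin_sum (i j l : 'I_n) : (sin (th i + th j + th l) == 0) = (n %| i + j + l)%N.
Proof. by rewrite -sin_fracpi_eq0 // /th !natrD !mulrDl. Qed.

Let cv (j : 'I_n) : 'cV[R]_3 := \col_i [:: cos (th j); sin (th j); - sin3 (th j)]`_i.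

Let dot (v : 'rV[R]_3) j : (v *m cv j) 0 0 = v 0 (inord 0) * cos (th j)
  + v 0 (inord 1) * sin (th j) - v 0 (inord 2) * sin3 (th j).
Proof.
rewrite mxE !big_ord_recl big_ord0 !mxE /= addr0 mulrN addrA.
by congr (_ * _ + _ * _ - _ * _); congr (v 0 _); apply/val_inj; rewrite /= inordK.
Qed.

Let on P j := rep P *m cv j == 0.

(** When the last term of the identity vanishes, the equation of the l-th line, times a nonzero
    sine, is a combination of the other two. *)
Let on_third P (i j l : 'I_n) : i != j -> on P i -> on P j -> (n %| i + j + l)%N -> on P l.
Proof.
rewrite /on !dot_eq0 !dot => ij /eqP Pi /eqP Pj; rewrite -sin_sum => /eqP S.
have := deltoid_identity (th i) (th j) (th l) (rep P 0 (inord 0))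
  (rep P 0 (inord 1)) (rep P 0 (inord 2)).
rewrite Pi Pj S !mulr0 !addr0 => /eqP.
by rewrite mulf_eq0 (negbTE (sin_diff ij)).
Qed.

Let on_sum P (i j l : 'I_n) : i != j -> j != l -> l != i -> on P i -> on P j -> on P l ->
  (n %| i + j + l)%N.
Proof.
rewrite /on !dot_eq0 !dot => ij jl li /eqP Pi /eqP Pj /eqP Pl.
have := deltoid_identity (th i) (th j) (th l) (rep P 0 (inord 0))
  (rep P 0 (inord 1)) (rep P 0 (inord 2)).
rewrite Pi Pj Pl !mulr0 !add0r => /esym/eqP; rewrite !mulf_eq0.
have nz (u v : 'I_n) : u != v -> (sin (th u - th v) == 0) = false.
  by move=> uv; apply/negbTE/sin_diff; rewrite eq_sym.
rewrite (nz _ _ ij) (nz _ _ jl) (nz _ _ li) sin_sum pnatr_eq0 /=.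
(* The other factor is z. At z = 0 the lines i and j, of different directions, force x = y = 0. *)
case/orP => // /eqP z0; exfalso; move: Pi Pj; rewrite z0 !mul0r !subr0.
set x := rep P 0 (inord 0); set y := rep P 0 (inord 1) => Pi Pj.
have x0 : x = 0.
  apply/eqP; rewrite -(mulIr_eq0 _ (mulIf (sin_diff ij))) sinB.
  have -> : x * (sin (th j) * cos (th i) - cos (th j) * sin (th i)) =
    sin (th j) * (x * cos (th i) + y * sin (th i)) -
    sin (th i) * (x * cos (th j) + y * sin (th j)) by ring.
  by rewrite Pi Pj !mulr0 subr0.
have y0 : y = 0.
  apply/eqP; rewrite -(mulIr_eq0 _ (mulIf (sin_diff ij))) sinB.
  have -> : y * (sin (th j) * cos (th i) - cos (th j) * sin (th i)) =
    cos (th i) * (x * cos (th j) + y * sin (th j)) -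
    cos (th j) * (x * cos (th i) + y * sin (th i)) by ring.
  by rewrite Pi Pj !mulr0 subr0.
suff : rep P = 0 by apply/eqP; exact: rep_neq0.
apply/rowP => m; rewrite mxE -[m]inord_val.
by case: m => -[|[|[|m]]] //= mlt; rewrite -?/x -?/y.
Qed.

(** The point at infinity of line i lies on line j only if sin (th j - th i) = 0. *)
Let cvI : injective (fun i => line_of (cv i)).
Proof.
move=> i j /= e; apply/eqP/negPn/negP => ij.
pose v : 'rV[R]_3 := \row_m [:: - sin (th i); cos (th i); 0]`_m.
have vE m : v *m cv m == 0 = (- sin (th i) * cos (th m) + cos (th i) * sin (th m) == 0).
  by rewrite dot_eq0 dot !mxE !inordK //= mul0r subr0.
have v0 : v != 0.
  apply/eqP => v0; have := cos2Dsin2 (th i); move/rowP: v0 => v0.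
  have := v0 (inord 0); have := v0 (inord 1); rewrite !mxE !inordK //= => -> /eqP.
  rewrite oppr_eq0 => /eqP ->; rewrite !expr0n /= addr0 => /esym/eqP.
  by rewrite oner_eq0.
have [P [t t0 Pv]] := exists_pt v0.
have PE m : (P \in line_of (cv m)) = (v *m cv m == 0).
  by rewrite mem_line_of Pv -scalemxAl scaler_eq0 (negbTE t0).
have := PE i; rewrite e PE !vE.
have -> : - sin (th i) * cos (th i) + cos (th i) * sin (th i) = 0 by ring.
have -> : - sin (th i) * cos (th j) + cos (th i) * sin (th j) = sin (th j - th i).
  by rewrite sinB; ring.
by rewrite eqxx (negbTE (sin_diff ij)).
Qed.

Let cv0 i : cv i != 0.
Proof.
apply/eqP => /colP v0; have := cos2Dsin2 (th i).
have := v0 (inord 0); have := v0 (inord 1); rewrite !mxE !inordK //= => -> ->.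
by rewrite !expr0n /= addr0 => /esym/eqP; rewrite oner_eq0.
Qed.

Let I2 : (2 <= #|'I_n|)%N. Proof. by rewrite card_ord; lia. Qed.
Let A := family_arrangement cv.
Let lA : line_arrangement A := family_line_arrangement cvI cv0 I2.

Let multE P : point_mult A P = #|[set i | on P i]%SET|.
Proof.
rewrite (family_mult cvI) -sum1_card [RHS]big_mkcond; apply: eq_bigr => i _.
by rewrite inE /on; case: eqP.
Qed.

Let third (i j : 'I_n) : {l : 'I_n | (n %| i + j + l)%N}.
Proof.
(* Starting from 2 n keeps the natural subtraction from truncating. *)
have lt : ((2 * n - i - j) %% n < n)%N by rewrite ltn_mod.
exists (Ordinal lt) => /=; rewrite /dvdn modnDmr.
have -> : (i + j + (2 * n - i - j) = 2 * n)%N.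
  by have := ltn_ord i; have := ltn_ord j; lia.
by rewrite modnMl.
Qed.

Let sum_uniq (i j l l' : 'I_n) : (n %| i + j + l)%N -> (n %| i + j + l')%N -> l = l'.
Proof.
move=> /eqP d /eqP d'; apply/val_inj; rewrite /= -(modn_small (ltn_ord l)).
rewrite -[RHS](modn_small (ltn_ord l')); apply/eqP.
by rewrite -(eqn_modDl (i + j)) d d'.
Qed.

(** By [on_sum], a further line through the intersection of lines i and j has index l with n | i + j
    + l, which is unique. *)
Let mult_le3 P : (point_mult A P <= 3)%N.
Proof.
have [|] := ltnP 1 (point_mult A P); last by lia.
rewrite multE => /card_gt1P[i [j [Pi Pj ij]]]; rewrite !inE in Pi Pj.
have [l dl] := third i j.
have sub : [set m | on P m]%SET \subset [set i; j; l]%SET.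
  apply/fintype.subsetP => m; rewrite !inE => Pm.
  case: (eqVneq m i) => //= mi; case: (eqVneq m j) => //= mj.
  by apply/eqP/(sum_uniq (on_sum ij _ mi Pi Pj Pm) dl); rewrite eq_sym.
apply: (leq_trans (subset_leq_card sub)).
rewrite (leq_trans (leq_card_setU _ _)) // cards1 cards2; by case: (i != j).
Qed.

Let t2 := (\sum_(P <- verts A) (point_mult A P == 2))%N.

(* A double point lies on lines i and j with n | 2 i + j, hence is determined
   by i. *)
Let t2_le : (t2 <= n)%N.
Proof.
pose F := [set P : verts A | point_mult A (val P) == 2]%SET.
have -> : t2 = #|F|.
  rewrite /t2 big_seq_fsetE /= -sum1_card [RHS]big_mkcond /=.
  by apply: eq_bigr => P _; rewrite inE; case: eqP.
rewrite -[leqRHS]card_ord.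
apply: (@card_le_rel _ _ _ (fun (P : verts A) (i : 'I_n) =>
  [exists j : 'I_n, [&& i != j, on (val P) i, on (val P) j & (n %| i + i + j)%N]])).
  move=> P; rewrite inE multE => /cards2P[i [j [ij Pij]]].
  have Pi : on (val P) i by have := set21 i j; rewrite -Pij inE.
  have Pj : on (val P) j by have := set22 i j; rewrite -Pij inE.
  have [l dl] := third i j.
  (* The line l with n | i + j + l passes through P too, so at a double point it is i or j. *)
  have : l \in [set i; j]%SET by rewrite -Pij inE; exact: on_third ij Pi Pj dl.
  rewrite !inE => /orP[] /eqP e; rewrite e in dl.
    by exists i; apply/existsP; exists j; rewrite ij Pi Pj /= addnAC.
  exists j; apply/existsP; exists i.
  by rewrite eq_sym ij Pi Pj /= [X in (_ %| X)%N]addnC addnA.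
move=> P P' i _ _ /existsP[j /and4P[ij Pi Pj d]] /existsP[j' /and4P[_ Pi' Pj' d']].
rewrite -(sum_uniq d d') in Pj'; apply/val_inj.
apply: (meet_unique _ (cv0 i) (cv0 j)); try exact/eqP.
by move=> /cvI e; rewrite e eqxx in ij.
Qed.

Let sum_t2 : (\sum_(P <- verts A) point_mult A P + t2 = 3 * #|` verts A|)%N.
Proof.
rewrite /t2 card_fset_sum1 big_distrr -big_split /= !big_seq.
apply: eq_bigr => P; rewrite in_verts // => m2; have := mult_le3 P.
by case: (point_mult A P) m2 => [|[|[|[|]]]].
Qed.

Let sum_sqr_t2 : (\sum_(P <- verts A) point_mult A P ^ 2 + 5 * t2 = 9 * #|` verts A|)%N.
Proof.
rewrite /t2 card_fset_sum1 !big_distrr -big_split /= !big_seq.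
apply: eq_bigr => P; rewrite in_verts // => m2; have := mult_le3 P.
by case: (point_mult A P) m2 => [|[|[|[|]]]].
Qed.

Lemma deltoid_arrangement : exists A : {fset set (proj_plane R)},
  [/\ admissible A, #|` A| = n, (n * n.-1 <= 6 * #|` verts A|)%N,
      (\sum_(P <- verts A) point_mult A P <= 3 * #|` verts A|)%N &
      (3 * #|` verts A| <= \sum_(P <- verts A) point_mult A P + n)%N].
Proof.
exists A; have dA : #|` A| = n by rewrite card_family ?card_ord.
split=> //.
- apply/admissibleP; rewrite ?dA //; first by lia.
  by move=> P; apply: leq_trans (mult_le3 P) _; lia.
(* Here n (n - 1) = Q - T = 6 s - 4 t2. *)
- by have := sum_mult_sqr lA; have := sum_t2; have := sum_sqr_t2; rewrite dA; lia.
- by have := sum_t2; lia.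
- by have := sum_t2; have := t2_le; lia.
Qed.

End Deltoid.

Lemma real_density (R : realType) (a b : R) : -3 < a -> a < b -> b <= -2 ->
  exists2 h, HL_values R R h & a < h < b.
Proof.
move=> a3 ab b2.
(* The first summand makes the steps short, with B = 1; the second makes the initial value, at most
   -3 + 2 n / s <= -3 + 2 / K, lie below [a]. *)
pose K := (Num.truncn (2 / (b - a) + 2 / (a + 3))).+1.
have ba : 0 < b - a by lra.
have a30 : 0 < a + 3 by lra.
have KP : 2 / (b - a) + 2 / (a + 3) < K%:R.
  by exact: truncnS_gt.
have K1 : 1 + 1 < K%:R * (b - a).
  rewrite -ltr_pdivrMr //; apply: le_lt_trans KP.
  by rewrite lerDl divr_ge0 // ltW.
have K2 : 2 < K%:R * (a + 3).
  rewrite -ltr_pdivrMr //; apply: le_lt_trans KP.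
  by rewrite lerDr divr_ge0 // ltW.
(* Then n - 1 >= 6 K, so s >= n (n - 1) / 6 >= K n; the 5 secures n >= 5. *)
pose n := (6 * K + 5)%N.
have [|A [aA dA nS T3 S3]] := @deltoid_arrangement R n; first by rewrite /n; lia.
have lA := aA.1; have s0 := verts_gt0 lA.
have KS : (K * n <= #|` verts A|)%N by move: nS; rewrite /n addnS /=; nia.
have HA := HL_sum_mult R lA.
have s0R : 0 < #|` verts A|%:R :> R by rewrite ltr0n.
have fI : injective (fun n : nat => n%:R : R) by exact: mulrIn (oner_neq0 _).
have [||||||h0 hV hab] := @HL_density R R _ a b 1 K%:R
   (\sum_(P <- verts A) point_mult A P)%N A fI b2 _ _ K1 aA.
- by [].
- by rewrite ltr0n.
- rewrite HA dA ler_pdivlMr // ler_pdivrMr //; apply/andP; split.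
    by move: T3; rewrite -(ler_nat R) natrM; have := ler0n R n; lra.
  move: S3 KS; rewrite -!(ler_nat R) !natrM natrD => S3 KS.
  have : 2 * n%:R <= K%:R * (a + 3) * n%:R by rewrite ler_wpM2r // ltW.
  have : 0 <= (a + 3) * (#|` verts A|%:R - K%:R * n%:R).
    by rewrite mulr_ge0 ?subr_ge0 // ltW.
  by lra.
- by rewrite dA ler_nat /n; lia.
- by rewrite dA -natrM ler_nat.
- by lia.
- by exists h0.
Qed.

(** * Accumulation points *)

Lemma limit_point_itv (R : realType) (E : set R) (r l u : R) :
  (forall a b, l < a -> a < b -> b <= u ->
    exists2 h, E h & a < h < b) ->
  l <= r <= u -> l < u -> limit_point E r.
Proof.
move=> dE /andP[lr ru] lu U /nbhs_ballP[e /= e0 reU].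
(* An interval on one side of r keeps h distinct from r: on the left when l < r, on the right when r
   = l. *)
have [a [b [la ab bu rab]]] : exists a b,
    [/\ l < a, a < b, b <= u & forall h, a < h < b -> h != r /\ `|r - h| < e].
  have [lr'|] := ltP l r.
    exists ((Num.max l (r - e) + r) / 2), r.
    have := lr'; have : r - e < r by lra.
    case: (leP l (r - e)) => h1 h2 h3; split; try lra;
      by move=> h /andP[ah hr]; rewrite lt_eqF // ger0_norm; lra.
  move=> rl; have {rl} rl : r = l by lra.
  exists (l + Num.min (u - l) e / 2), (l + Num.min (u - l) e).
  have : 0 < u - l by lra.
  case: (leP (u - l) e) => h1 h2; split; try lra;
    by move=> h /andP[ah hr]; rewrite gt_eqF ?ler0_norm; lra.
have [h Eh /rab[hr rh]] := dE a b la ab bu.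
by exists h; split=> //; apply: reU.
Qed.

Theorem proposition4p9 (R : realType) :
  [/\ forall k : fieldType,
        limit_point (HL_values R k) `<=` [set` `]-oo, (-2)]],
      forall p : nat, prime p ->
        limit_point (HL_values_pchar R p) = [set` `]-oo, (-2)]]
    & limit_point (HL_values R R) = [set` `[-3, -2]]].
Proof.
split=> [k|p pp|].
- by apply: limit_point_HL => h hV; exists k.
- apply/seteqP; split.
    by apply: limit_point_HL => h [k [_ hV]]; exists k.
  move=> r /=; rewrite in_itv /= => r2.
  (* In characteristic p there is no lower limit, so any left end below r will do. *)
  apply: (@limit_point_itv _ _ _ (r - 1) (-2)); last by lra.
    by move=> a b _; exact: pchar_density.
  by apply/andP; split; lra.
- apply/seteqP; split=> r /=; rewrite in_itv /=.
    have EV h : HL_values R R h -> exists k : fieldType, HL_values R k h.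
      by move=> hV; exists R.
    move=> rE; have := limit_point_HL EV rE.
    rewrite /= in_itv /= => ->; rewrite andbT leNgt; apply/negP => r3.
    (* A limit point below -3 would have values below -3 near it, against [HL_ge]. *)
    have [h [_ [A aA <-]]] := rE [set x | x < -3] (lt_nbhsl r3).
    by rewrite /= ltNge HL_ge //; exact: aA.1.
  move=> r32; apply: (@limit_point_itv _ _ _ (-3) (-2)) => //; last by lra.
  exact: real_density.
Qed.
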